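(* Let \(\mu\) be a cardinal with \(\mu=\mu^{<\mu}>\aleph_0\) and let \(\lambda=\mu^+\). For each \(\alpha<\lambda\) fix a continuously increasing sequence \(\langle a^\alpha_i:i<\mu\rangle\) of subsets of \(\alpha\) with \(\alpha=\bigcup_{i<\mu}a^\alpha_i\) and \(|a^\alpha_i|<\mu\), and define \(f_\alpha:\mu\to\mu\) by \(f_\alpha(i)=\mathrm{otp}(a^\alpha_i)\). Suppose that for every club \(C\subseteq\lambda\) there is some \(X\subseteq\mu\times\mu\) such that for all \(\alpha<\lambda\): if \(\alpha\in C\) then \(\{i<\mu:(i,f_\alpha(i))\in X\}\) contains a club of \(\mu\), and if \(\alpha\notin C\) then \(\{i<\mu:(i,f_\alpha(i))\notin X\}\) contains a club of \(\mu\). Then there is a sentence \(\varphi\in L_{\lambda\lambda}\) such that for all \(A\subseteq\lambda\): \(\langle\lambda,<,A\rangle\models\varphi\) if and only if \(A\) is stationary in \(\lambda\).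
   Context: \(\mathrm{otp}\) denotes order type. A sequence \(\langle a_i:i<\mu\rangle\) is continuously increasing if it is \(\subseteq\)-increasing and \(a_\nu=\bigcup_{i<\nu}a_i\) for limit \(\nu\). \(L_{\lambda\lambda}\) is the infinitary logic with conjunctions/disjunctions of fewer than \(\lambda\) formulas and quantification over blocks of fewer than \(\lambda\) variables; \(<\) is the ordinal order on \(\lambda\). *)

(* Defs.v *)
From HB Require Import structures.
From mathcomp Require Import all_boot all_order.
From mathcomp Require Import boolp classical_sets functions cardinality.
From mathcomp Require wochoice.

Set Implicit Arguments.
Unset Strict Implicit.
Unset Printing Implicit Defensive.

Local Open Scope classical_set_scope.
Local Open Scope card_scope.
Local Open Scope order_scope.

Definition card_lt (T U : Type) (A : set T) (B : set U) : bool :=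
  (A #<= B) && ~~ (B #<= A).

(* An ordinal is represented by a totally ordered type whose order is a
   well-order; its elements stand for the smaller ordinals, x being identified
   with the initial segment [seg x]. *)
Section Ordinals.
Context {d : Order.disp_t}.

Definition is_ordinal (T : orderType d) : Prop :=
  wochoice.well_order (<=%O : rel T).

Definition seg {T : orderType d} (x : T) : set T := [set y | y < x].

Definition is_cardinal (T : orderType d) : Prop :=
  is_ordinal T /\ forall x : T, card_lt (seg x) [set: T].

(* The union over x < T of the sets of functions from x to T; its cardinality
   is T^{<T}. *)
Definition bounded_seqs (T : orderType d) : Type :=
  {x : T & {y : T | y < x} -> T}.

Definition is_limit {T : orderType d} (x : T) : Prop :=
  seg x !=set0 /\ forall y, y < x -> exists2 z, y < z & z < x.

Definition unbounded {T : orderType d} (C : set T) : Prop :=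
  forall x, exists2 y, C y & x < y.

Definition closed_set {T : orderType d} (C : set T) : Prop :=
  forall x, is_limit x ->
    (forall y, y < x -> exists z, [/\ C z, y < z & z < x]) -> C x.

Definition is_club {T : orderType d} (C : set T) : Prop :=
  closed_set C /\ unbounded C.

Definition contains_club {T : orderType d} (S : set T) : Prop :=
  exists2 C, is_club C & C `<=` S.

Definition stationary {T : orderType d} (S : set T) : Prop :=
  forall C, is_club C -> S `&` C !=set0.

Definition continuously_increasing {T : orderType d} {U : Type}
    (a : T -> set U) : Prop :=
  (forall i j, i <= j -> a i `<=` a j) /\
  (forall n, is_limit n -> a n = \bigcup_(i in seg n) a i).

End Ordinals.

(* L is the least ordinal of cardinality greater than M. *)
Definition is_succ_cardinal {d d' : Order.disp_t}
    (M : orderType d) (L : orderType d') : Prop :=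
  [/\ is_ordinal L, card_lt [set: M] [set: L]
    & forall x : L, ~ card_lt [set: M] (seg x)].

Definition order_isomorphic {d d' : Order.disp_t}
    {T : orderType d} {U : orderType d'} (A : set T) (B : set U) : Prop :=
  exists2 g : T -> U, set_bij A B g &
    forall x y, A x -> A y -> (g x < g y) = (x < y).

Definition is_otp {d d' : Order.disp_t} {T : orderType d} {U : orderType d'}
    (A : set T) (m : U) : Prop :=
  order_isomorphic A (seg m).

(* The formulas of L_{kk}, k = |K|, in the vocabulary {<, P} with equality,
   with free variables in V. Scoping is intrinsic: a quantifier over a block
   of variables B turns the free variables V + B of its body into V, and
   sentences have free variables in the empty type. *)
Inductive formula (K V : Type) : Type :=
| Eq of V & V
| Lt of V & V
| Pr of V
| Not of formula K V
| And (I : Type) of card_lt [set: I] [set: K] & (I -> formula K V)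
| Or (I : Type) of card_lt [set: I] [set: K] & (I -> formula K V)
| Ex (B : Type) of card_lt [set: B] [set: K] & formula K (V + B)
| All (B : Type) of card_lt [set: B] [set: K] & formula K (V + B).

Definition sentence (K : Type) : Type := formula K void.

Definition extend {V B T : Type} (s : V -> T) (t : B -> T) (v : V + B) : T :=
  match v with inl x => s x | inr b => t b end.

Fixpoint sat {T : Type} (lt : T -> T -> Prop) (A : set T) {K V : Type}
    (phi : formula K V) : (V -> T) -> Prop :=
  match phi with
  | Eq x y => fun s => s x = s y
  | Lt x y => fun s => lt (s x) (s y)
  | Pr x => fun s => A (s x)
  | Not p => fun s => ~ sat lt A p s
  | And J _ p => fun s => forall i : J, sat lt A (p i) s
  | Or J _ p => fun s => exists i : J, sat lt A (p i) s
  | Ex B _ p => fun s => exists t : B -> T, sat lt A p (extend s t)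
  | All B _ p => fun s => forall t : B -> T, sat lt A p (extend s t)
  end.

Definition models {T : Type} (lt : T -> T -> Prop) (A : set T) {K : Type}
    (phi : sentence K) : Prop :=
  sat lt A phi (of_void T).

(* Main.v *)
(** Blocks of |M| variables let a sentence quantify over the sets X of pairs
    from M. Modulo a club, f_alpha(i) is the order type of the first i values
    below alpha of any enumeration of alpha in type M, because two continuous
    filtrations of alpha by small sets agree on a club of the regular cardinal
    M; hence "f_alpha(i) is X-related to i for club many i" is expressible in
    L_{lambda lambda}. By hypothesis every club of L has the form
    C_X = {alpha | (i, f_alpha(i)) in X for club many i}, since the two cases
    exclude each other, so stationarity of A says: for all X, if C_X is a club
    then C_X meets A. *)

Require Import Defs.
From HB Require Import structures.
From mathcomp Require Import all_boot all_order.
From mathcomp Require Import boolp classical_sets functions cardinality.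
From mathcomp Require Import finmap.
From Stdlib Require Eqdep_dec.

Import Order.TTheory.

Local Open Scope classical_set_scope.
Local Open Scope card_scope.
Local Open Scope order_scope.

(** * Cardinal comparison and least elements of well-orders *)

Lemma card_le_setTP {T U : Type} {B : set U} :
  [set: T] #<= B <-> exists2 e : T -> U, injective e & forall t, B (e t).
Proof.
split=> [/card_leP[g]|[e einj Be]].
  exists (fun t => val (g (SigSub (in_setT t)))) => [s t /val_inj|t].
    by move/(inj (in_setT _) (in_setT _)) => -[].
  exact: set_mem (valP (g _)).
apply: card_le_trans (subset_card_le (_ : range e `<=` B)); last first.
  by move=> _ [t _ <-].
by have := inj_card_eq (in2W einj : {in [set: T] &, injective e});
  rewrite card_eq_sym card_eq_le => /andP[].
Qed.

Lemma card_le_lt_trans {T U W : Type} (A : set T) (B : set U) (C : set W) :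
  A #<= B -> card_lt B C -> card_lt A C.
Proof.
move=> AB /andP[BC nCB]; apply/andP; split; first exact: card_le_trans BC.
by apply: contra nCB => CA; apply: card_le_trans AB.
Qed.

Lemma card_lt_le_trans {T U W : Type} (A : set T) (B : set U) (C : set W) :
  card_lt A B -> B #<= C -> card_lt A C.
Proof.
move=> /andP[AB nBA] BC; apply/andP; split; first exact: card_le_trans BC.
by apply: contra nBA => CA; apply: card_le_trans CA.
Qed.

Lemma ordinal_min {d} {T : orderType d} {P : set T} :
  is_ordinal T -> P !=set0 -> exists2 m, P m & forall y, P y -> m <= y.
Proof.
move=> woT [x Px]; case: (woT (mem P)) => [|m [[Pm mP] _]].
  by exists x; apply/mem_set.
by exists m => [|y Py]; [apply/set_mem|apply: mP; apply/mem_set].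
Qed.

(** * Order types: uniqueness and increasing enumerations *)

Section OrderTypes.
Context {d d' : Order.disp_t} {T : orderType d} {U : orderType d'}.

(** A strictly increasing map of ordinals never moves a point down. For m < n, composing [g] with
    the inverse [k] of [h] maps seg n into seg m and moves m down; applied to the least point moved
    down, it yields a smaller one. *)
Lemma otp_unique (A : set T) (m n : U) :
  is_ordinal U -> is_otp A m -> is_otp A n -> m = n.
Proof.
move=> woU; wlog lt_mn : m n / m < n.
  by case: (ltgtP m n) => // mn W Am An; [|symmetry]; apply: W.
move=> [g [gS gI gJ] gM] [h [hS hI hJ] hM]; exfalso.
have kE x : exists y, x < n -> [/\ A y, h y = x & g y < m].
  case: (ltP x n) => [/hJ[y Ay <-]|_]; first by exists y; split=> //; exact: gS.
  by case: (hJ m lt_mn) => y _ _; exists y.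
case: (choice kE) => k {}kE.
have [|x [lt_xn xg] xmin] :=
    ordinal_min (P := [set x | x < n /\ g (k x) < x]) woU.
  by exists m; split=> //; have [] := kE m lt_mn.
have lt_gn := lt_trans xg lt_xn.
have [Ax hx _] := kE x lt_xn; have [Ag hg _] := kE _ lt_gn.
suff /xmin : [set x | x < n /\ g (k x) < x] (g (k x)) by rewrite leNgt xg.
by split=> //; rewrite gM // -hM // hx hg.
Qed.

(** The inverse isomorphism is a family of elements of [T] indexed by [U], which a block of
    variables can range over. Its values from m on are irrelevant, and [x0] supplies them. *)
Lemma is_otpP (A : set T) (x0 : T) (m : U) :
  is_otp A m <-> exists z : U -> T,
    [/\ forall k l, k < l -> l < m -> z k < z l,
        forall l, l < m -> A (z l) &
        forall y, A y -> exists2 l, l < m & z l = y].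
Proof.
split=> [[g [gS gI gJ] gM]|[z [zM zS zJ]]].
  have zE l : exists y, l < m -> A y /\ g y = l.
    by case: (ltP l m) => [/gJ[y Ay gy]|_]; [exists y|exists x0].
  case: (choice zE) => z {}zE; exists z; split=> [k l kl lm|l /zE[]//|y Ay].
    have [Az gz] := zE l lm; have [Ak gk] := zE k (lt_trans kl lm).
    by rewrite -gM // gz gk.
  have gym : g y < m by exact: gS.
  exists (g y) => //; have [Az gz] := zE _ gym.
  by apply: gI => //; apply/mem_set.
have gE y : exists l, A y -> l < m /\ z l = y.
  by case: (pselect (A y)) => [/zJ[l lm zl]|?]; [exists l|exists m].
case: (choice gE) => g {}gE.
have gM x y : A x -> A y -> (g x < g y) = (x < y).
  move=> /gE[xm zx] /gE[ym zy]; rewrite -{2}zx -{2}zy.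
  case: (ltgtP (g x) (g y)) => [lt|lt|->]; last by rewrite ltxx.
    by rewrite zM.
  by rewrite ltNge (ltW (zM _ _ lt xm)).
exists g => //; split=> [y /gE[]//| |l lm].
  by move=> x y /set_mem/gE[_ zx] /set_mem/gE[_ zy] gxy; rewrite -zx -zy gxy.
 exists (z l); first exact: zS.
have [gm zg] := gE _ (zS l lm).
case: (ltgtP (g (z l)) l) => // lt.
  by have := zM _ _ lt lm; rewrite zg ltxx.
by have := zM _ _ lt gm; rewrite zg ltxx.
Qed.

End OrderTypes.

(** * Uncountable cardinals: regularity, closure points and clubs *)

Lemma bounded_seq_inj {d} {T : orderType d} (x : T) (G H : {y : T | y < x} -> T) :
  existT _ x G = existT _ x H :> bounded_seqs T -> G = H.
Proof. exact: (Eqdep_dec.inj_pair2_eq_dec T (@eq_comparable T)). Qed.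

Section UncountableCardinal.
Context {d : Order.disp_t} {M : orderType d}.
Hypotheses (hM : is_cardinal M) (hMunc : card_lt [set: nat] [set: M]).

(** If all segments were finite, their sizes would embed [M] in the natural numbers. *)
Lemma infinite_seg_exists : exists x : M, [set: nat] #<= seg x.
Proof.
apply: contrapT => noinf; move/andP: hMunc => -[_ /negP]; apply.
have fin (x : M) : finite_set (seg x).
  by apply: contrapT => inf; apply: noinf; exists x; apply/infiniteP.
pose r (x : M) := #|` fset_set (seg x)|.
have rlt x y : x < y -> (r x < r y)%N.
  move=> xy; apply: fproper_ltn_card; rewrite fproperE.
  apply/andP; split; first by rewrite -fset_set_sub // => z /lt_trans; apply.
  by apply/negP; rewrite -fset_set_sub // => /(_ x xy); rewrite /seg /= ltxx.
apply/card_le_setTP; exists r => // x y rxy.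
by case: (ltgtP x y) => // /rlt; rewrite rxy ltnn.
Qed.

(** Hilbert's hotel: if x were greatest, sending x to [e 0] and each [e n] to [e n.+1], with all
    else fixed, would inject [M] into seg x. *)
Lemma cardinal_no_max (x : M) : exists y, x < y.
Proof.
apply: contrapT => xmax.
have le_x y : y <= x by rewrite leNgt; apply/negP => xy; apply: xmax; exists y.
have [x0 /card_le_setTP[e einj e0]] := infinite_seg_exists.
have ex n : e n < x by apply: lt_le_trans (e0 n) (le_x _).
have /andP[_ /negP] := hM.2 x; apply; apply/card_le_setTP.
have sE y : exists z, [/\ y = x -> z = e 0%N, forall n, y = e n -> z = e n.+1 &
    y <> x -> (forall n, y <> e n) -> z = y].
  case: (pselect (y = x)) => [->|yx].
    exists (e 0%N); split=> // n xe.
    by have := ex n; rewrite -xe ltxx.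
  case: (pselect (exists n, y = e n)) => [[n ->]|ny].
    exists (e n.+1); split=> // [xe|m /einj->//|_ /(_ n)//].
    by have := ex n; rewrite xe ltxx.
  by exists y; split=> // n ye; case: ny; exists n.
have [s {}sE] := choice sE.
have sP y : [\/ y = x /\ s y = e 0%N, exists2 n, y = e n & s y = e n.+1 |
    [/\ y <> x, forall n, y <> e n & s y = y]].
  have [s1 s2 s3] := sE y.
  case: (pselect (y = x)) => [yx|yx]; first by constructor 1; rewrite s1.
  case: (pselect (exists n, y = e n)) => [[n ye]|ny].
    by constructor 2; exists n => //; apply: s2.
  have ny' n : y <> e n by move=> ye; apply: ny; exists n.
  by constructor 3; split=> //; apply: s3.
exists s => [y z|y]; last first.
  case: (sP y) => [[_ ->]|[n _ ->]|[yx _ ->]] //; first exact: ex.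
    exact: ex.
  by rewrite /seg /= lt_neqAle le_x andbT; apply/eqP.
case: (sP y) => [[-> ->]|[n -> ->]|[yx yn ->]];
  case: (sP z) => [[-> ->]|[m -> ->]|[zx zn ->]] //.
- by move/einj.
- by move/esym/zn.
- by move/einj.
- by move/einj => [->].
- by move/esym/zn.
- by move/yn.
- by move/yn.
Qed.

Hypothesis hMpow : [set: bounded_seqs M] #<= [set: M].

(** A pair is coded by the function on an infinite segment with its first entry at [e 0] and its
    second elsewhere; the values at [e 0] and [e 1] recover it. *)
Lemma prod_card_le : [set: M * M] #<= [set: M].
Proof.
apply: card_le_trans hMpow; have [x /card_le_setTP[e einj ex]] := infinite_seg_exists.
apply/card_le_setTP.
exists (fun p => existT _ x (fun y => if sval y == e 0%N then p.1 else p.2)) => //.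
move=> [i j] [k l] /bounded_seq_inj ijkl.
have := congr1 (fun h => h (exist _ (e 0%N) (ex 0%N))) ijkl.
have := congr1 (fun h => h (exist _ (e 1%N) (ex 1%N))) ijkl.
by rewrite /= eqxx; case: eqP => [/einj//|_ -> ->].
Qed.

(* Koenig's diagonal argument: a cofinal g on seg x would yield a function on
   seg x that differs from every G coded below g y at y. *)
Lemma cardinal_regular (x : M) (g : M -> M) :
  exists m, forall y, y < x -> g y <= m.
Proof.
move/card_le_setTP: hMpow => [c cinj _]; apply: contrapT => unb.
have cof m : exists2 y, y < x & m < g y.
  apply: contrapT => nog; apply: unb; exists m => y yx.
  by rewrite leNgt; apply/negP => mg; apply: nog; exists y.
have FE (y : {y | y < x}) : exists v, forall G : {y | y < x} -> M,
    c (existT _ x G) < g (sval y) -> v <> G y.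
  apply: contrapT => nov.
  have rE v : exists m, exists2 G : {y | y < x} -> M,
      c (existT _ x G) = m /\ m < g (sval y) & v = G y.
    apply: contrapT => noG; apply: nov; exists v => G cG vG; apply: noG.
    by exists (c (existT _ x G)), G.
  (* If every v were the value at y of some G coded below [g y], sending v to such a code would
     inject [M] into seg (g y). *)
  have [r {}rE] := choice rE.
  have /andP[_ /negP] := hM.2 (g (sval y)); apply; apply/card_le_setTP.
  exists r => [v w vw|v]; last by have [G []] := rE v.
  have [G [cG _] ->] := rE v; have [H [cH _] ->] := rE w.
  move: cG; rewrite vw -cH => /cinj.
  by move/bounded_seq_inj => ->.
have [F {}FE] := choice FE.
have [y yx cg] := cof (c (existT _ x F)).
exact: (FE (exist _ y yx) F cg).
Qed.

(** The point is the supremum of an increasing sequence [u] starting at x, each term of which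
    exceeds all values of [h] below the previous term. *)
Lemma closure_point (h : M -> M) (x : M) :
  exists i, [/\ x < i, is_limit i & forall j, j < i -> h j < i].
Proof.
have stepE i : exists k, i < k /\ forall j, j < i -> h j < k.
  have [m hm] := cardinal_regular i h.
  have [k mk] := cardinal_no_max (Order.max m i).
  move: mk; rewrite gt_max => /andP[mk ik]; exists k; split=> // j ji.
  exact: le_lt_trans (hm j ji) mk.
have [step {}stepE] := choice stepE.
pose u n := iter n step x.
have uS n : u n < u n.+1 by have [] := stepE (u n).
have [x0 /card_le_setTP[e einj ex]] := infinite_seg_exists.
(* Carrying [u] along [e] to the segment of [x0] lets regularity bound it; off the range of [e] the
   value is arbitrary. *)
have gE y : exists v, forall n, e n = y -> v = u n.
  case: (pselect (exists n, e n = y)) => [[n <-]|ny]; last first.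
    by exists x => n ye; case: ny; exists n.
  by exists (u n) => m /einj->.
have [g {}gE] := choice gE; have [m gm] := cardinal_regular x0 g.
have [|i ui imin] := ordinal_min (P := [set i | forall n, u n <= i]) hM.1.
  by exists m => n; rewrite -(gE _ n erefl) gm //; exact: ex.
have u_cof j : j < i -> exists n, j < u n.
  move=> ji; apply: contrapT => nou; move: ji; rewrite ltNge => /negP; apply.
  by apply: imin => n; rewrite leNgt; apply/negP => ju; apply: nou; exists n.
have u_lt n : u n < i := lt_le_trans (uS n) (ui n.+1).
exists i; split=> [||j /u_cof[n jn]]; first exact: (u_lt 0%N).
  by split=> [|j /u_cof[n jn]]; [exists (u 0%N); exact: u_lt|exists (u n)].
by apply: lt_le_trans (ui n.+1); have [_] := stepE (u n); apply.
Qed.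

(** For unboundedness, [h] picks a point of each club above j; a limit closed under both choices is
    a limit of points of each club. *)
Lemma is_clubI (C D : set M) : is_club C -> is_club D -> is_club (C `&` D).
Proof.
move=> [Ccl Cub] [Dcl Dub]; split=> [x xlim xCD|x].
  split; [apply: Ccl|apply: Dcl] => // y /xCD[z [[Cz Dz] yz zx]]; by exists z.
have hE j : exists p, [/\ C p.1, D p.2, j < p.1 & j < p.2].
  by have [k Ck jk] := Cub j; have [l Dl jl] := Dub j; exists (k, l).
have [h {}hE] := choice hE.
have [i [xi ilim hi]] := closure_point (fun j => Order.max (h j).1 (h j).2) x.
exists i => //; split; [apply: Ccl|apply: Dcl] => // y /hi;
  rewrite gt_max => /andP[h1 h2]; have [C1 D2 y1 y2] := hE y.
- by exists (h y).1.
- by exists (h y).2.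
Qed.

Lemma is_club_neq0 (C : set M) : is_club C -> C !=set0.
Proof.
move=> [_ Cub]; have [x _] := infinite_seg_exists.
by have [y Cy _] := Cub x; exists y.
Qed.

(** At a limit closed under the witnesses of mutual cofinality, each member below it of one sequence
    lies in a member below it of the other, so by continuity the two agree there. *)
Lemma is_club_eq {U : Type} (b c : M -> set U) :
  continuously_increasing b -> continuously_increasing c ->
  (forall i, exists j, b i `<=` c j) -> (forall i, exists j, c i `<=` b j) ->
  is_club [set i | b i = c i].
Proof.
move=> [bM bC] [cM cC] bc cb; split=> [x xlim xeq|x].
  rewrite /= bC // cC //; apply/seteqP; split=> y [i ix yi];
    have [z [bcz iz zx]] := xeq i ix; exists z => //.
    by rewrite -bcz; apply: bM yi; apply: ltW.
  by rewrite /= bcz; apply: cM yi; apply: ltW.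
have hE j : exists p, b j `<=` c p.1 /\ c j `<=` b p.2.
  by have [k bk] := bc j; have [l cl] := cb j; exists (k, l).
have [h {}hE] := choice hE.
have [i [xi ilim hi]] := closure_point (fun j => Order.max (h j).1 (h j).2) x.
exists i => //=; rewrite bC // cC //.
apply/seteqP; split=> y [j /= ji]; have := hi j ji; rewrite gt_max => /andP[h1 h2].
- by move/(hE j).1 => ?; exists (h j).1.
- by move/(hE j).2 => ?; exists (h j).2.
Qed.

End UncountableCardinal.

(** * Enumerations of alpha and the canonical functions modulo clubs *)

Section Enumerations.
Context {d d' : Order.disp_t} {M : orderType d} {L : orderType d'}.

(** The filtration of alpha given by [x]. Values outside alpha are discarded, so [x] need only cover
    alpha, and alpha = 0 is no exception. *)
Definition initial_image (x : M -> L) (alpha : L) (i : M) : set L :=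
  [set y | y < alpha /\ exists2 k, k < i & x k = y].

Lemma initial_image_continuous (x : M -> L) (alpha : L) :
  continuously_increasing (initial_image x alpha).
Proof.
split=> [i j ij y [yal [k ki xk]]|n [_ nlim]].
  by split=> //; exists k => //; apply: lt_le_trans ij.
apply/seteqP; split=> y.
  move=> [yal [k kn xk]]; have [z kz zn] := nlim k kn.
  by exists z => //; split=> //; exists k.
move=> [i /= ni [yal [k ki xk]]]; split=> //; exists k => //.
exact: lt_trans ni.
Qed.

(* The canonical function f_alpha is determined modulo a club by alpha alone,
   so it may be replaced by the order types of the initial images of an
   arbitrary enumeration of alpha; this makes the condition expressible. *)
Definition club_trace (X : set (M * M)) (alpha : L) : Prop :=
  exists x : M -> L, seg alpha `<=` range x /\
  exists E : set M, is_club E /\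
  forall i, E i -> exists j, is_otp (initial_image x alpha i) j /\ X (i, j).

Hypotheses (hM : is_cardinal M) (hMunc : card_lt [set: nat] [set: M])
  (hMpow : [set: bounded_seqs M] #<= [set: M]).
Context {alpha : L} {a : M -> set L} {f : M -> M}.
Hypotheses (a_sub : forall i, a i `<=` seg alpha)
  (a_cont : continuously_increasing a)
  (a_cover : seg alpha = \bigcup_i a i)
  (hf : forall i, is_otp (a i) (f i)).

(** An element of alpha is addressed by an index i with it in [a i] and its image under an injection
    of [a i] into [M]; [p] codes addresses in [M], and other arguments of [x] get an arbitrary
    value. *)
Lemma enumeration_exists : exists x : M -> L, seg alpha `<=` range x.
Proof.
have gE i : exists g : L -> M, {in a i &, injective g}.
  by have [g [_ gI _] _] := hf i; exists g.
have [g {}gE] := choice gE.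
have /card_le_setTP[p pinj _] := prod_card_le hMunc hMpow.
have xE m : exists z, forall i y, a i y -> p (i, g i y) = m -> z = y.
  case: (pselect (exists i y, a i y /\ p (i, g i y) = m)) => [|no].
    move=> [i [y [ay <-]]]; exists y => j z az /pinj[ji]; subst j.
    by move/gE => -> //; apply/mem_set.
  by exists alpha => i y ay pm; case: no; exists i, y.
have [x {}xE] := choice xE.
exists x; rewrite a_cover => y [i _ ay]; exists (p (i, g i y)) => //.
exact: xE ay erefl.
Qed.

(** Mutual cofinality comes from regularity: the [x]-indices of the elements of [a i], at most one
    for each ordinal below [f i], are bounded, and so are the stages of [a] at which the values
    [x k] below alpha, k < i, have appeared. *)
Lemma is_club_initial_image (x : M -> L) : seg alpha `<=` range x ->
  is_club [set i | a i = initial_image x alpha i].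
Proof.
move=> xcov; apply: is_club_eq => // [|i|i]; first exact: initial_image_continuous.
  have [g [gS gI gJ] _] := hf i.
  have kE m : exists k, forall y, a i y -> g y = m -> x k = y.
    case: (pselect (exists2 y, a i y & g y = m)) => [[y ay <-]|no].
      have [k _ xk] := xcov y (a_sub i y ay).
      by exists k => z az gzy; rewrite xk; apply: gI => //; apply/mem_set.
    by exists m => y ay gy; case: no; exists y.
  have [k {}kE] := choice kE.
  have [m km] := cardinal_regular hM hMpow (f i) k.
  have [n mn] := cardinal_no_max hM hMunc m.
  exists n => y ay; split; first exact: (a_sub i).
  exists (k (g y)); last exact: kE.
  by apply: le_lt_trans mn; apply: km; apply: gS.
have kE k : exists j, x k < alpha -> a j (x k).
  case: (pselect (seg alpha (x k))) => [|no]; last by exists i.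
  by rewrite {1}a_cover => -[j _ ?]; exists j.
have [h {}hE] := choice kE.
have [m hm] := cardinal_regular hM hMpow i h.
exists m => y [yal [k ki xk]]; have [aM _] := a_cont.
by apply: (aM (h k)); [exact: hm|rewrite -xk; apply: hE; rewrite xk].
Qed.

(** On the club where [a i] equals the initial image, uniqueness of order types forces j = [f i]. *)
Lemma club_traceP (X : set (M * M)) :
  club_trace X alpha <-> contains_club [set i | X (i, f i)].
Proof.
split=> [[x [xcov [E [Eclub EX]]]]|[E Eclub EX]].
  exists (E `&` [set i | a i = initial_image x alpha i]).
    by apply: is_clubI => //; exact: is_club_initial_image.
  move=> i [/EX[j [otpj Xj]] /= ai].
  by rewrite /= (otp_unique _ _ _ hM.1 (hf i) (_ : is_otp (a i) j)) // ai.
have [x xcov] := enumeration_exists; exists x; split=> //.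
exists (E `&` [set i | a i = initial_image x alpha i]); split.
  by apply: is_clubI => //; exact: is_club_initial_image.
by move=> i [/EX Xi /= <-]; exists (f i).
Qed.

End Enumerations.

(** * Closure properties of definable relations *)

Section Definability.
Context {d : Order.disp_t} {L : orderType d}.

(** One formula must serve all A and all assignments. Working with relations lets the closure lemmas
    assemble the formula without explicit syntax. *)
Definition definable {V : Type} (P : set L -> (V -> L) -> Prop) : Prop :=
  exists phi : formula L V, forall A s,
    sat (fun x y : L => x < y) A phi s <-> P A s.

Lemma definable_eq {V : Type} (v w : V) : definable (fun A s => s v = s w).
Proof. by exists (Eq L v w). Qed.

Lemma definable_lt {V : Type} (v w : V) : definable (fun A s => s v < s w).
Proof. by exists (Lt L v w). Qed.

Lemma definable_mem {V : Type} (v : V) : definable (fun A s => A (s v)).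
Proof. by exists (Pr L v). Qed.

Lemma definable_not {V : Type} (P : set L -> (V -> L) -> Prop) :
  definable P -> definable (fun A s => ~ P A s).
Proof.
by move=> [phi phiP]; exists (Not phi) => A s /=; split=> nP /phiP.
Qed.

Lemma definable_forall {V I : Type} (P : I -> set L -> (V -> L) -> Prop) :
  card_lt [set: I] [set: L] ->
  (forall i, definable (P i)) -> definable (fun A s => forall i, P i A s).
Proof.
move=> cI /choice[phi phiP]; exists (And cI phi) => A s /=.
by split=> sP i; apply/phiP.
Qed.

Lemma definable_exists {V I : Type} (P : I -> set L -> (V -> L) -> Prop) :
  card_lt [set: I] [set: L] ->
  (forall i, definable (P i)) -> definable (fun A s => exists i, P i A s).
Proof.
move=> cI /choice[phi phiP]; exists (Or cI phi) => A s /=.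
by split=> -[i sP]; exists i; apply/phiP.
Qed.

Lemma definable_forall_block {V B : Type}
    (P : set L -> (V -> L) -> (B -> L) -> Prop) :
  card_lt [set: B] [set: L] ->
  definable (fun A (s : V + B -> L) => P A (s \o inl) (s \o inr)) ->
  definable (fun A s => forall t, P A s t).
Proof.
move=> cB [phi phiP]; exists (All cB phi) => A s /=.
(* The restrictions of [extend s t] along [inl] and [inr] are convertible to [s] and [t]. *)
by split=> sP t; apply/(phiP A (extend s t)).
Qed.

Lemma definable_exists_block {V B : Type}
    (P : set L -> (V -> L) -> (B -> L) -> Prop) :
  card_lt [set: B] [set: L] ->
  definable (fun A (s : V + B -> L) => P A (s \o inl) (s \o inr)) ->
  definable (fun A s => exists t, P A s t).
Proof.
move=> cB [phi phiP]; exists (Ex cB phi) => A s /=.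
by split=> -[t sP]; exists t; apply/(phiP A (extend s t)).
Qed.

Lemma definable_ext {V : Type} (P Q : set L -> (V -> L) -> Prop) :
  (forall A s, P A s <-> Q A s) -> definable P -> definable Q.
Proof.
by move=> PQ [phi phiP]; exists phi => A s; rewrite phiP.
Qed.

Hypothesis Lunc : card_lt [set: nat] [set: L].

Lemma countable_card_lt {I : Type} : countable [set: I] ->
  card_lt [set: I] [set: L].
Proof. by move=> cI; apply: card_le_lt_trans Lunc. Qed.

Lemma definable_and {V : Type} (P Q : set L -> (V -> L) -> Prop) :
  definable P -> definable Q -> definable (fun A s => P A s /\ Q A s).
Proof.
move=> dP dQ.
apply: (definable_ext (fun A s => forall b : bool, (if b then P else Q) A s)).
  move=> A s; split=> [PQ|[p q] []//]; split; [exact: PQ true|exact: PQ false].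
by apply: definable_forall; [exact: countable_card_lt|case].
Qed.

(** Facts such as k < l in [M] are external to the structure. Such a Q becomes a disjunction over a
    type inhabited exactly when Q holds, each disjunct being the negated empty disjunction. *)
Lemma definable_const {V : Type} (Q : Prop) :
  definable (fun A (s : V -> L) => Q).
Proof.
apply: (definable_ext (fun A s =>
    exists i : {i : unit | `[<Q>]}, ~ exists j : void, True)).
  move=> A s; split=> [[[i /asboolP//]]|q].
  by exists (exist _ tt (asboolT q)) => -[].
apply: definable_exists => [|i]; first exact: countable_card_lt.
apply: definable_not; apply: definable_exists => [|//].
exact: countable_card_lt.
Qed.

Lemma definable_imply {V : Type} (P Q : set L -> (V -> L) -> Prop) :
  definable P -> definable Q -> definable (fun A s => P A s -> Q A s).
Proof.
move=> dP dQ; apply: (definable_ext (fun A s => ~ (P A s /\ ~ Q A s))).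
  by move=> A s; rewrite not_andP notK implyE.
by apply: definable_not; apply: definable_and => //; apply: definable_not.
Qed.

Lemma definable_forall1 {V : Type} (P : set L -> (V -> L) -> L -> Prop) :
  definable (fun A (s : V + unit -> L) => P A (s \o inl) (s (inr tt))) ->
  definable (fun A s => forall x, P A s x).
Proof.
move=> dP.
apply: (definable_ext (fun A s => forall t : unit -> L, P A s (t tt))).
  by move=> A s; split=> [sP x|//]; exact: sP (fun=> x).
by apply: definable_forall_block => //; exact: countable_card_lt.
Qed.

Lemma definable_exists1 {V : Type} (P : set L -> (V -> L) -> L -> Prop) :
  definable (fun A (s : V + unit -> L) => P A (s \o inl) (s (inr tt))) ->
  definable (fun A s => exists x, P A s x).
Proof.
move=> dP.
apply: (definable_ext (fun A s => exists t : unit -> L, P A s (t tt))).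
  by move=> A s; split=> [[t tP]|[x xP]]; [exists (t tt)|exists (fun=> x)].
by apply: definable_exists_block => //; exact: countable_card_lt.
Qed.

(** * Quantification over sets by blocks of variables *)

Lemma exists_lt : exists l0 l1 : L, l0 < l1.
Proof.
have /andP[/card_le_setTP[e einj _] _] := Lunc.
by case: (ltgtP (e 0%N) (e 1%N)) => [? | ? | /einj //]; do 2 eexists; eassumption.
Qed.

(** Blocks range over families of elements only; two families code a set of indices by their
    pointwise comparison, with no element of [L] having to be named. *)
Lemma set_code {I : Type} (X : set I) :
  exists t u : I -> L, X = [set i | t i < u i].
Proof.
have [l0 [l1 lt01]] := exists_lt.
exists (fun=> l0), (fun i => if `[<X i>] then l1 else l0).
apply/seteqP; split=> i /=; case: asboolP => //.
by rewrite ltxx.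
Qed.

Lemma definable_forall_set {V I : Type}
    (P : set L -> (V -> L) -> set I -> Prop) :
  card_lt [set: I] [set: L] ->
  definable (fun A (s : V + I + I -> L) =>
    P A (s \o inl \o inl) [set i | s (inl (inr i)) < s (inr i)]) ->
  definable (fun A s => forall X, P A s X).
Proof.
move=> cI dP; apply: (definable_ext (fun A s =>
    forall t u : I -> L, P A s [set i | t i < u i])) => [A s|].
  by split=> // sP X; have [t [u ->]] := set_code X.
apply: definable_forall_block => //; exact: definable_forall_block.
Qed.

Lemma definable_exists_set {V I : Type}
    (P : set L -> (V -> L) -> set I -> Prop) :
  card_lt [set: I] [set: L] ->
  definable (fun A (s : V + I + I -> L) =>
    P A (s \o inl \o inl) [set i | s (inl (inr i)) < s (inr i)]) ->
  definable (fun A s => exists X, P A s X).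
Proof.
move=> cI dP; apply: (definable_ext (fun A s =>
    exists t u : I -> L, P A s [set i | t i < u i])) => [A s|].
  split=> [[t [u sP]]|[X]]; first by exists [set i | t i < u i].
  by have [t [u ->]] := set_code X; exists t, u.
apply: definable_exists_block => //; exact: definable_exists_block.
Qed.

(** * Definability of limits, clubs, order types and club traces *)

Lemma definable_is_limit {V : Type} (v : V) :
  definable (fun A s => is_limit (s v)).
Proof.
apply: (definable_ext (fun A s => (exists y, y < s v) /\
    forall y, y < s v -> exists z, y < z /\ z < s v)) => [A s|].
  split=> -[ne lim]; split=> // y /lim; first by move=> [z []]; exists z.
  by move=> [z]; exists z.
apply: definable_and.
  apply: definable_exists1; exact: definable_lt (inr tt) (inl v).
apply: definable_forall1; apply: definable_imply.
  exact: definable_lt (inr tt) (inl v).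
apply: definable_exists1; apply: definable_and.
  exact: definable_lt (inl (inr tt)) (inr tt).
exact: definable_lt (inr tt) (inl (inl v)).
Qed.

Context {d' : Order.disp_t} {M : orderType d'}.
Hypotheses (hML : card_lt [set: M] [set: L])
  (hMM : [set: M * M] #<= [set: M]).

(** Quantifiers over [M] become conjunctions and disjunctions indexed by [M], of size below |L|, and
    the order of [M] enters as constants. *)
Lemma definable_is_club {V : Type} (E : set L -> (V -> L) -> set M) :
  (forall i, definable (fun A s => E A s i)) ->
  definable (fun A s => is_club (E A s)).
Proof.
move=> dE; apply: (definable_ext (fun A s =>
    (forall x, is_limit x ->
      (forall y, y < x -> exists z, E A s z /\ (y < z /\ z < x)) -> E A s x) /\
    (forall x, exists y, E A s y /\ x < y))) => [A s|].
  split=> -[cl ub]; split=> [x xlim xE|x].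
  - by apply: cl => // y /xE[z [? ? ?]]; exists z.
  - by have [y []] := ub x; exists y.
  - by apply: cl => // y /xE[z [? [? ?]]]; exists z.
  - by have [y] := ub x; exists y.
apply: definable_and; apply: definable_forall => // x; last first.
  apply: definable_exists => // y.
  by apply: definable_and => //; exact: definable_const.
apply: definable_imply; first exact: definable_const.
apply: definable_imply => //; apply: definable_forall => // y.
apply: definable_imply; first exact: definable_const.
apply: definable_exists => // z; apply: definable_and => //.
exact: definable_const.
Qed.

Lemma definable_initial_image {V : Type} (x : M -> V) (v w : V) (i : M) :
  definable (fun A s => initial_image (s \o x) (s v) i (s w)).
Proof.
apply: (definable_ext (fun A s =>
    s w < s v /\ exists k, k < i /\ s (x k) = s w)) => [A s|].
  by split=> -[wv]; [move=> [k []]|move=> [k]]; split=> //; exists k.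
apply: definable_and; first exact: definable_lt.
apply: definable_exists => // k; apply: definable_and.
  exact: definable_const.
exact: definable_eq.
Qed.

Lemma definable_is_otp {V : Type} (x : M -> V) (v : V) (i j : M) :
  definable (fun A s => is_otp (initial_image (s \o x) (s v) i) j).
Proof.
apply: (definable_ext (fun A s => exists z : M -> L,
    (forall k l, k < l -> l < j -> z k < z l) /\
    ((forall l, l < j -> initial_image (s \o x) (s v) i (z l)) /\
    (forall y, initial_image (s \o x) (s v) i y ->
      exists l, l < j /\ z l = y)))) => [A s|].
  rewrite (is_otpP _ (s v)); split=> [[z [? [? zJ]]]|[z [? ? zJ]]]; exists z.
    by split=> // y /zJ[l []]; exists l.
  by split=> //; split=> // y /zJ[l]; exists l.
apply: definable_exists_block => //; apply: definable_and.
  apply: definable_forall => // k; apply: definable_forall => // l.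
  apply: definable_imply; first exact: definable_const.
  apply: definable_imply; first exact: definable_const.
  exact: definable_lt (inr k) (inr l).
apply: definable_and.
  apply: definable_forall => // l.
  apply: definable_imply; first exact: definable_const.
  exact: definable_initial_image (inl \o x) (inl v) (inr l) i.
apply: definable_forall1; apply: definable_imply.
  exact: definable_initial_image (inl \o inl \o x) (inl (inl v)) (inr tt) i.
apply: definable_exists => // l; apply: definable_and.
  exact: definable_const.
exact: definable_eq (inl (inr l)) (inr tt).
Qed.

(** X is given by its code: membership of (i, j) is the atomic formula comparing the variables
    [t (i, j)] and [u (i, j)]. The enumeration is one block and the club E two. *)
Lemma definable_club_trace {V : Type} (t u : M * M -> V) (v : V) :
  definable (fun A s => club_trace [set p | s (t p) < s (u p)] (s v)).
Proof.
apply: (definable_ext (fun A s => exists x : M -> L,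
    (forall y, y < s v -> exists k, x k = y) /\
    exists E : set M, is_club E /\
    forall i, E i -> exists j, is_otp (initial_image x (s v) i) j /\
      s (t (i, j)) < s (u (i, j)))) => [A s|].
  split=> -[x [xcov E]]; exists x; split=> // y /xcov [k]; first by exists k.
  by exists k.
apply: definable_exists_block => //; apply: definable_and.
  apply: definable_forall1; apply: definable_imply.
    exact: definable_lt (inr tt) (inl (inl v)).
  apply: definable_exists => // k.
  exact: definable_eq (inl (inr k)) (inr tt).
apply: definable_exists_set => //; apply: definable_and.
  apply: definable_is_club => i; exact: definable_lt.
apply: definable_forall => // i; apply: definable_imply.
  exact: definable_lt.
apply: definable_exists => // j; apply: definable_and.
  exact: definable_is_otp (inl \o inl \o inr) (inl (inl (inl v))) i j.
exact: definable_lt (inl (inl (inl (t (i, j))))) (inl (inl (inl (u (i, j))))).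
Qed.

(** The club now lies in [L] itself, so single variables range over its points and the order is that
    of the structure. *)
Lemma definable_club_trace_is_club {V : Type} (t u : M * M -> V) :
  definable (fun A s =>
    is_club [set x : L | club_trace [set p | s (t p) < s (u p)] x]).
Proof.
pose T (s : V -> L) (x : L) := club_trace [set p | s (t p) < s (u p)] x.
apply: (definable_ext (fun A s =>
    (forall x, is_limit x ->
      (forall y, y < x -> exists z, T s z /\ (y < z /\ z < x)) -> T s x) /\
    (forall x, exists y, T s y /\ x < y))) => [A s|].
  split=> -[cl ub]; split=> [x xlim xE|x].
  - by apply: cl => // y /xE[z [? ? ?]]; exists z.
  - by have [y []] := ub x; exists y.
  - by apply: cl => // y /xE[z [? [? ?]]]; exists z.
  - by have [y] := ub x; exists y.
apply: definable_and; apply: definable_forall1; last first.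
  apply: definable_exists1; apply: definable_and.
    exact: definable_club_trace (inl \o inl \o t) (inl \o inl \o u) (inr tt).
  exact: definable_lt (inl (inr tt)) (inr tt).
apply: definable_imply; first exact: definable_is_limit.
apply: definable_imply; last first.
  exact: definable_club_trace (inl \o t) (inl \o u) (inr tt).
apply: definable_forall1; apply: definable_imply.
  exact: definable_lt (inr tt) (inl (inr tt)).
apply: definable_exists1; apply: definable_and.
  exact: definable_club_trace (inl \o inl \o inl \o t)
    (inl \o inl \o inl \o u) (inr tt).
apply: definable_and; first exact: definable_lt (inl (inr tt)) (inr tt).
exact: definable_lt (inr tt) (inl (inl (inr tt))).
Qed.

Lemma club_trace_sentence : exists phi : sentence L, forall A : set L,
  models (fun x y : L => x < y) A phi <->
  forall X : set (M * M), is_club [set x : L | club_trace X x] ->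
    exists x, A x /\ club_trace X x.
Proof.
have [phi phiP] : definable (fun A (s : void -> L) =>
    forall X : set (M * M), is_club [set x : L | club_trace X x] ->
      exists x, A x /\ club_trace X x); last by exists phi => A; apply: phiP.
apply: definable_forall_set; first exact: card_le_lt_trans hML.
apply: definable_imply; first exact: definable_club_trace_is_club.
apply: definable_exists1; apply: definable_and; first exact: definable_mem.
exact: definable_club_trace (inl \o inl \o inr) (inl \o inr) (inr tt).
Qed.

End Definability.

(** * Stationarity expressed through club traces *)

Theorem theorem13 (d d' : Order.disp_t) (M : orderType d) (L : orderType d')
  (hM : is_cardinal M)
  (hMunc : card_lt [set: nat] [set: M])
  (hMpow : [set: bounded_seqs M] #= [set: M])
  (hL : is_succ_cardinal M L)
  (a : L -> M -> set L)
  (a_sub : forall alpha i, a alpha i `<=` seg alpha)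
  (a_cont : forall alpha, continuously_increasing (a alpha))
  (a_cover : forall alpha, seg alpha = \bigcup_i a alpha i)
  (a_card : forall alpha i, card_lt (a alpha i) [set: M])
  (f : L -> M -> M)
  (hf : forall alpha i, is_otp (a alpha i) (f alpha i))
  (hclub : forall C : set L, is_club C ->
     exists X : set (M * M), forall alpha : L,
       (C alpha -> contains_club [set i | X (i, f alpha i)]) /\
       (~ C alpha -> contains_club [set i | ~ X (i, f alpha i)])) :
  exists phi : sentence L, forall A : set L,
    models (fun x y : L => x < y) A phi <-> stationary A.
Proof.
have [_ MltL _] := hL.
have pow_le : [set: bounded_seqs M] #<= [set: M].
  by move: hMpow; rewrite card_eq_le => /andP[].
have natL : card_lt [set: nat] [set: L].
  by move: (MltL) => /andP[+ _]; apply: card_lt_le_trans.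
have traceP alpha X :
    club_trace X alpha <-> contains_club [set i | X (i, f alpha i)].
  exact: (club_traceP hM hMunc pow_le (a_sub alpha)).
have [phi phiP] := club_trace_sentence natL MltL (prod_card_le hMunc pow_le).
exists phi => A; rewrite phiP.
split=> [AX C Cclub|Astat X /Astat[x []]]; last by exists x.
have [X XC] := hclub C Cclub.
suff traceC : [set x : L | club_trace X x] = C.
  have [|x [Ax Xx]] := AX X; first by rewrite traceC.
  by exists x; rewrite -traceC.
apply/seteqP; split=> x; last by move=> /(XC x).1 /traceP.
(* A point of the trace outside C would give a club inside X and a club avoiding X, and two clubs of
   [M] meet. *)
move=> /traceP[E Eclub EX]; apply: contrapT => /(XC x).2[F Fclub FX].
have EFclub := is_clubI hM hMunc pow_le _ _ Eclub Fclub.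
by have [i [/EX Xi /FX]] := is_club_neq0 hMunc _ EFclub.
Qed.
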